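(* If $T$ is a tree of order $n$, then $\eta(T)\le 2a(T)-n$.
   Context: The nullity $\eta(T)$ is the multiplicity of the eigenvalue $0$ of the adjacency matrix of $T$. For a graph $G$ with $m$ edges and vertex degrees sorted as $d_1\le d_2\le\dots\le d_n$, the annihilation number $a(G)$ is the largest index $a$ such that $\sum_{i=1}^{a} d_i\le m$. *)

(* Defs.v *)
From HB Require Import structures.
From mathcomp Require Import all_boot all_order all_algebra.

Set Implicit Arguments.
Unset Strict Implicit.
Unset Printing Implicit Defensive.

Import GRing.Theory.

Local Open Scope nat_scope.

Record sgraph := SGraph {
  vertex :> finType;
  adj : rel vertex;
  adj_sym : symmetric adj;
  adj_irrefl : irreflexive adj
}.

Definition edge_set (G : sgraph) : {set {set G}} :=
  [set [set p.1; p.2] | p : G * G & adj p.1 p.2].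

Definition deg (G : sgraph) (x : G) : nat := #|[set y | adj x y]|.

Definition connected_graph (G : sgraph) : Prop :=
  0 < #|G| /\ forall x y : G, connect (@adj G) x y.

(* Closed walks of length 2 run along one edge and are not cycles, hence the
   lower bound on the size. *)
Definition acyclic_graph (G : sgraph) : Prop :=
  forall c : seq G, 2 < size c -> ~ ucycle (@adj G) c.

Definition is_tree (G : sgraph) : Prop := connected_graph G /\ acyclic_graph G.

Definition degree_seq (G : sgraph) : seq nat :=
  sort leq [seq deg x | x <- enum G].

Definition annihilation (G : sgraph) : nat :=
  \max_(a < #|G|.+1 | sumn (take a (degree_seq G)) <= #|edge_set G|) a.

Definition adjacency_mx (R : nzRingType) (G : sgraph) : 'M[R]_#|G| :=
  (\matrix_(i, j) (adj (enum_val i) (enum_val j))%:R)%R.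

(* Multiplicity of 0 as a root of the characteristic polynomial. *)
Definition nullity (R : realFieldType) (G : sgraph) : nat :=
  mup 0%R (char_poly (adjacency_mx R G)).

(* Main.v *)
(* For an independent set S, each edge meets S at most once, so the degrees over
   S sum to at most m and |S| <= a(T). It thus suffices to find S independent
   with eta(T) <= 2|S| - n. Removing a leaf v and its neighbour u lowers the
   rank of the adjacency matrix by at least 2, while v can be added back to any
   independent set of the rest; repeating until no edge is left gives
   rank >= 2(n - |S|). Finally, a real symmetric matrix satisfies ker A^2 = ker A,
   so the algebraic multiplicity of 0 is at most n - rank. *)
Require Import Defs.
From mathcomp Require Import all_boot all_order all_algebra.
From mathcomp Require Import zify.

Set Implicit Arguments.
Unset Strict Implicit.
Unset Printing Implicit Defensive.
Import GRing.Theory Num.Theory.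
Local Open Scope ring_scope.

(** * Multiplicity of 0 as a root of the characteristic polynomial *)

(** Take determinants in ('X - A)('X - B) = 'X ('X - (A + B)), where the term A B has vanished. *)
Lemma char_poly_mulmx0 (R : comNzRingType) n (A B : 'M[R]_n) :
  A *m B = 0 -> char_poly A * char_poly B = 'X^n * char_poly (A + B).
Proof.
move=> AB0; rewrite /char_poly -det_mulmx -detZ; congr (\det _).
rewrite /char_poly_mx mulmxBl !mulmxBr -map_mxM AB0 map_mx0 subr0.
rewrite -scalar_mxM mul_mx_scalar mul_scalar_mx scalerBr map_mxD scalerDr opprD.
by rewrite scale_scalar_mx addrAC addrA.
Qed.

(** Left multiplication by the inverse [L] of [col_ebase A] clears the last n - r rows of [A]. Those
    rows of L ('X - A) are thus 'X times rows of [L], and each gives a factor 'X of the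
    determinant. *)
Lemma mup_char_poly_ge (F : fieldType) n (A : 'M[F]_n) :
  (n - \rank A <= mup 0 (char_poly A))%N.
Proof.
rewrite mup_geq ?monic_neq0 ?char_poly_monic // subr0.
set r := \rank A; set L := invmx (col_ebase A).
pose d : 'rV[{poly F}]_n := \row_i if (i < r)%N then 1 else 'X.
pose LA := map_mx polyC L *m char_poly_mx A.
pose N : 'M[{poly F}]_n :=
  \matrix_(i, j) if (i < r)%N then LA i j else (L i j)%:P.
have eLA : LA = diag_mx d *m N.
  rewrite mul_diag_mx; apply/matrixP => i j; rewrite [RHS]mxE [d _ _]mxE [N _ _]mxE.
  case: ltnP => [|le_ri]; first by rewrite mul1r.
  rewrite /LA /char_poly_mx mulmxBr mul_mx_scalar -map_mxM /= -{1}(mulmx_ebase A).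
  rewrite !mulmxA (mulVmx (col_ebase_unit A)) mul1mx !mxE.
  rewrite big1 ?subr0 // => k _.
  by rewrite mxE ltnNge le_ri andbF mul0r.
have L0 : \det L != 0 by rewrite -unitfE -unitmxE unitmx_inv col_ebase_unit.
have: \det LA = \det (diag_mx d) * \det N by rewrite eLA det_mulmx.
rewrite det_mulmx det_map_mx mul_polyC det_diag => eqd.
rewrite -(dvdpZr _ _ L0) -/(char_poly A) eqd; apply: dvdp_mulr.
suff -> : \prod_i d 0 i = 'X^(n - r) by [].
rewrite (eq_bigr (fun i : 'I_n => if (i < r)%N then 1 else 'X)); last first.
  by move=> i _; rewrite mxE.
rewrite -(big_mkord xpredT (fun i => if (i < r)%N then 1 else 'X)).
rewrite (big_cat_nat (n := r)) ?rank_leq_row //= big_nat big1 ?mul1r; last first.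
  by move=> i /andP[_ ->].
rewrite -prodr_const_nat big_nat [RHS]big_nat; apply: eq_bigr => i /andP[le_ri _].
by rewrite ltnNge le_ri.
Qed.

Lemma mulmx_tr_eq0 (R : realFieldType) n (v : 'rV[R]_n) : v *m v^T = 0 -> v = 0.
Proof.
move/matrixP/(_ 0 0)/eqP; rewrite !mxE psumr_eq0 => [/allP v0|i _]; last first.
  by rewrite mxE -expr2 sqr_ge0.
apply/rowP => i; have := v0 i (mem_index_enum _).
by rewrite !mxE mulf_eq0 orbb => /eqP.
Qed.

(* E := K^T K, with the rows of K spanning ker A, is symmetric with A E = 0
   and A + E invertible, so mup A + mup E = n, while mup E >= n - rank E. *)
Lemma mup_char_poly_sym (R : realFieldType) n (A : 'M[R]_n) :
  A^T = A -> (mup 0 (char_poly A) <= n - \rank A)%N.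
Proof.
move=> symA; pose K := kermx A; pose E := K^T *m K.
have KA0 : K *m A = 0 by apply: mulmx_ker.
have AKT : A *m K^T = 0 by rewrite -[A]symA -trmx_mul KA0 trmx0.
have AE0 : A *m E = 0 by rewrite mulmxA AKT mul0mx.
have unitAE : A + E \in unitmx.
  rewrite -row_free_unit; apply: inj_row_free => v vAE0.
  (* Since [E *m A = 0], multiplying [vAE0] by [A] leaves v A A = 0; by symmetry of [A], the row v A
     is then orthogonal to itself. *)
  have vA0 : v *m A = 0.
    apply: mulmx_tr_eq0; rewrite trmx_mul symA mulmxA.
    have : v *m (A + E) *m A = 0 by rewrite vAE0 mul0mx.
    rewrite mulmxDr mulmxDl -[v *m E *m A]mulmxA -[E *m A]mulmxA KA0 !mulmx0 addr0.
    by move->; rewrite mul0mx.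
  have vK0 : v *m K^T = 0.
    move: vAE0; rewrite mulmxDr vA0 add0r => vE0; apply: mulmx_tr_eq0.
    by rewrite (trmx_mul v) trmxK mulmxA -(mulmxA v) vE0 mul0mx.
  (* Now [v] lies in the kernel of [A] and is orthogonal to it, hence to itself. *)
  have /submxP[w vE] : (v <= K)%MS by apply/sub_kermxP.
  apply: mulmx_tr_eq0; rewrite {1}vE -mulmxA.
  by rewrite -[K]trmxK -trmx_mul vK0 trmx0 mulmx0.
have nz (B : 'M[R]_n) : char_poly B != 0 by rewrite monic_neq0 ?char_poly_monic.
have := congr1 (mup 0) (char_poly_mulmx0 AE0).
rewrite !mupM ?expf_neq0 ?polyX_eq0 //.
rewrite (_ : mup 0 'X^n = n); last by rewrite -['X]subr0 -polyC0 mup_XsubCX eqxx.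
rewrite (@mupNroot _ _ (char_poly (A + E))); last first.
  rewrite /root horner_coef0 char_poly_det mulf_neq0 ?signr_eq0 //.
  by rewrite -unitfE.
rewrite addn0 => /(canRL (addnK _)) ->.
have: (\rank E <= n - \rank A)%N by rewrite -mxrank_ker mxrankM_maxr.
by apply: leq_trans; rewrite leq_subCl mup_char_poly_ge.
Qed.

(** * Leaves, ranks and independent sets in a forest *)

(** The linear form [c] kills the row space of [B] but not [w], so [w] lies outside that space. *)
Lemma mxrank_adds_rV (F : fieldType) m n (B : 'M[F]_(m, n)) (w : 'rV_n)
    (c : 'cV_n) : B *m c = 0 -> w *m c != 0 -> \rank (B + w)%MS = (\rank B).+1.
Proof.
move=> Bc0 wc0; rewrite mxrank_disjoint_sum ?rank_rV.
  rewrite (_ : w != 0) ?addn1 //.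
  by apply: contraNneq wc0 => ->; rewrite mul0mx.
apply/eqP/rowV0P => x; rewrite sub_capmx => /andP[/submxP[y ->] /sub_rVP[a ea]].
have := congr1 (mulmx^~ c) ea; rewrite /= -mulmxA Bc0 mulmx0 -scalemxAl.
by move/esym/eqP; rewrite scaler_eq0 (negbTE wc0) orbF ea => /eqP->; rewrite scale0r.
Qed.

Definition independent (G : sgraph) (S : {set G}) :=
  {in S &, forall x y, ~~ adj x y}.

(** Vertices outside [A] keep zero rows and columns, so the matrix size does not change when
    vertices are deleted. *)
Definition induced_mx (F : fieldType) (G : sgraph) (A : {set G}) : 'M[F]_#|G| :=
  \matrix_(i, j) [&& adj (enum_val i) (enum_val j), enum_val i \in A
                   & enum_val j \in A]%:R.

(** Here [v] is the leaf and [u] its only neighbour within [A]. *)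
Definition is_leaf_in (G : sgraph) (A : {set G}) (u v : G) :=
  [/\ u \in A, v \in A & {in A, forall y, adj v y = (y == u)}].

(** Columns [u] and [v] of the smaller matrix vanish, while the row of [v] is the unit vector at [u]
    and the row of [u] has a 1 in column [v]. These two rows therefore each add 1 to the rank. *)
Lemma rank_induced_mx_leaf (F : fieldType) (G : sgraph) (A : {set G}) (u v : G) :
  is_leaf_in A u v ->
  (\rank (induced_mx F (A :\: [set u; v])) + 2 <= \rank (induced_mx F A))%N.
Proof.
move=> [uA vA leafv]; set M := induced_mx F A; set M' := induced_mx F _.
have vu : adj v u by rewrite leafv ?eqxx.
have neq_vu : v != u by apply: contraTneq vu => ->; rewrite adj_irrefl.
pose iu := enum_rank u; pose iv := enum_rank v.
have mulE m (B : 'M[F]_(m, _)) j i k : (B *m (delta_mx j 0 : 'cV_#|G|)) i k = B i j.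
  rewrite -[B *m _]trmxK trmx_mul trmx_delta -rowE !mxE //.
pose eu : 'rV[F]_#|G| := delta_mx 0 iu.
have rowv : row iv M = eu.
  apply/rowP => j; rewrite !mxE enum_rankK vA eqxx /= -(can_eq enum_valK) enum_rankK.
  case: (boolP (enum_val j \in A)) => [jA|]; first by rewrite leafv // andbT.
  by rewrite andbF; case: eqP => // ->; rewrite uA.
have sub : (M' + eu + row iu M <= M)%MS.
  rewrite !addsmx_sub row_sub -rowv row_sub !andbT.
  apply/row_subP => i.
  case: (boolP (enum_val i \in A :\: [set u; v])) => [iA|iNA]; last first.
    suff -> : row i M' = 0 by apply: sub0mx.
    by apply/rowP => j; rewrite !mxE (negbTE iNA) andbF.
  (* Subtracting a multiple of the leaf row clears column [u]; column [v] is already zero, since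
     vertex [i] is not [u]. *)
  suff -> : row i M' = row i M - M i iu *: row iv M.
    by rewrite addmx_sub ?row_sub // eqmx_opp scalemx_sub ?row_sub.
  move: (iA); rewrite !inE negb_or -andbA => /and3P[iu' iv' iA'].
  rewrite rowv; apply/rowP => j; rewrite !mxE iA eqxx /= -(can_eq enum_valK) enum_rankK.
  rewrite !inE iA' uA !andbT /=.
  case: (eqVneq (enum_val j) u) => [->|_] /=; first by rewrite andbF mulr1 uA andbT subrr.
  rewrite mulr0 subr0; case: (eqVneq (enum_val j) v) => //= ->.
  by rewrite vA andbF andbT adj_sym leafv // (negbTE iu').
have eu_iu : eu *m delta_mx iu 0 != 0 :> 'M_1.
  by apply/eqP => /matrixP/(_ 0 0)/eqP; rewrite mulE !mxE !eqxx oner_eq0.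
have M'0 x : x \in [set u; v] -> M' *m delta_mx (enum_rank x) 0 = 0 :> 'cV_#|G|.
  move=> xuv; apply/colP => i; rewrite mulE !mxE enum_rankK [x \in _ :\: _]in_setD xuv.
  by rewrite !andbF.
apply: leq_trans (mxrankS sub).
rewrite (@mxrank_adds_rV _ _ _ _ _ (delta_mx iv 0)).
- rewrite (mxrank_adds_rV _ eu_iu) ?addn2 //.
  by rewrite M'0 // !inE eqxx.
- apply/sub_kermxP; rewrite addsmx_sub !sub_kermx M'0 ?inE ?eqxx ?orbT //=.
  apply/eqP/matrixP => i k; rewrite mulE !mxE (inj_eq enum_rank_inj).
  by rewrite (negbTE neq_vu) andbF.
apply/eqP => /matrixP/(_ 0 0)/eqP; rewrite mulE !mxE !enum_rankK adj_sym vu uA vA.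
by rewrite oner_eq0.
Qed.

(* Otherwise any path in A extends at its head: the second neighbour of the
   head cannot lie on the path, as it would close a cycle. *)
Lemma acyclic_leaf (G : sgraph) (A : {set G}) (x y : G) :
  acyclic_graph G -> x \in A -> y \in A -> adj x y ->
  exists u v, is_leaf_in A u v.
Proof.
move=> acG xA yA xy.
case: (pickP [pred p : G * G | [&& p.1 \in A, p.2 \in A &
    [forall z in A, adj p.2 z == (z == p.1)]]]) => [[u v] /and3P[uA vA /= lf]|noleaf].
  exists u, v; split=> // z zA; exact/eqP/(implyP (forallP lf z)).
have other u v : u \in A -> v \in A -> adj v u ->
    exists2 z, z \in A & (z != u) && adj v z.
  move=> uA vA vu; have /= := noleaf (u, v); rewrite uA vA /=.
  move/negbT; rewrite negb_forall => /existsP[z].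
  rewrite negb_imply => /andP[zA neq]; exists z => //.
  by case: (eqVneq z u) neq => [->|_]; [rewrite vu | rewrite eqbF_neg negbK].
have long k : exists a b p, [/\ size p = k, uniq [:: a, b & p],
    path (@adj G) a (b :: p) & {subset [:: a, b & p] <= A}].
  elim: k => [|k [a [b [p [szp uq pth sA]]]]].
    exists x, y, [::]; split=> //=.
    + by rewrite inE andbT; apply: contraTneq xy => ->; rewrite adj_irrefl.
    + by rewrite xy.
    + by move=> z; rewrite !inE => /orP[]/eqP->.
  have aA : a \in A by apply: sA; rewrite inE eqxx.
  have bA : b \in A by apply: sA; rewrite !inE eqxx orbT.
  have ab : adj a b by case/andP: pth.
  have [z zA /andP[zb az]] := other b a bA aA ab.
  have za : z != a by apply: contraTneq az => ->; rewrite adj_irrefl.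
  case: (boolP (z \in p)) => [zp|zNp].
    (* As [z] comes after [b], the stretch from [a] to [z] has at least three vertices, and the edge
       between [a] and [z] closes it. *)
    case: (splitPr zp) uq pth => p1 p2 uq pth; exfalso.
    apply: (acG [:: a, b & rcons p1 z]); first by rewrite /= size_rcons.
    apply/andP; split.
      rewrite /cycle rcons_path /= last_rcons (adj_sym z) az andbT.
      by move: pth; rewrite -cat_rcons /= cat_path => /and3P[-> -> _].
    by move: uq; rewrite -cat_rcons -2!cat_cons cat_uniq => /andP[].
  exists z, a, (b :: p); split.
  - by rewrite /= szp.
  - by rewrite cons_uniq uq andbT !inE (negbTE za) (negbTE zb).
  - by rewrite /= adj_sym az.
  - by move=> t; rewrite inE => /orP[/eqP->|/sA].
(* For [k = #|G|] the path has two vertices more than the graph. *)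
have [a [b [p [szp /card_uniqP uq _ _]]]] := long #|G|.
by have := max_card (mem [:: a, b & p]); rewrite uq /= szp ltnNge leqnSn.
Qed.

(** Strong induction on [#|A|] inside the fixed graph [G]. Deleting a leaf and its neighbour lowers
    the left side by 4, matched by at least 2 from the rank and 2 from the leaf that joins [S]. *)
Lemma forest_independent_rank (F : fieldType) (G : sgraph) (A : {set G}) :
  acyclic_graph G -> exists S : {set G}, [/\ S \subset A, independent S &
    (2 * #|A| <= \rank (induced_mx F A) + 2 * #|S|)%N].
Proof.
move=> acG; have [k] := ubnP #|A|; elim: k A => // k IH A /ltnSE leAk.
case: (pickP [pred p : G * G | [&& p.1 \in A, p.2 \in A & adj p.1 p.2]]) => [[x y]|noedge].
  case/and3P=> /= xA yA xy.
  have [u [v lf]] := acyclic_leaf acG xA yA xy.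
  have [uA vA leafv] := lf.
  have neq_uv : u != v by apply: contraFneq (adj_irrefl v) => euv; rewrite leafv ?euv ?eqxx.
  have cA : #|A :\: [set u; v]| = (#|A| - 2)%N.
    rewrite cardsDS ?cards2 ?neq_uv //.
    by apply/subsetP => z; rewrite !inE => /orP[]/eqP->.
  (* This makes the truncated difference [#|A| - 2] exact. *)
  have geA : (2 <= #|A|)%N.
    apply: (leq_trans _ (subset_leq_card (_ : [set u; v] \subset A))).
      by rewrite cards2 neq_uv.
    by apply/subsetP => z; rewrite !inE => /orP[]/eqP->.
  have [|S [sSA indS leS]] := IH (A :\: [set u; v]); first by lia.
  have SA z : z \in S -> [&& z != u, z != v & z \in A].
    by move/(subsetP sSA); rewrite !inE negb_or -andbA.
  have vNS : v \notin S by apply/negP => /SA; rewrite eqxx andbF.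
  (* The leaf [v] may join [S]: its only neighbour in [A] is [u], which was deleted. *)
  exists (v |: S); split.
  - by apply/subsetP => z; rewrite !inE => /orP[/eqP->//|/SA/and3P[]].
  - have vS z : z \in S -> ~~ adj v z by move/SA/and3P=> [zu _ zA]; rewrite leafv.
    move=> a b; rewrite !inE => /orP[/eqP->|aS] /orP[/eqP->|bS].
    + by rewrite adj_irrefl.
    + exact: vS.
    + by rewrite adj_sym vS.
    + exact: indS.
  - have := rank_induced_mx_leaf F lf; rewrite cardsU1 vNS; move: leS geA; rewrite cA add1n.
    by move: (\rank _) (\rank _) #|A| #|S| => r' r a b; lia.
exists A; split=> //; last by rewrite leq_addl.
by move=> x y xA yA; have /= := noedge (x, y); rewrite xA yA /= => ->.
Qed.

(** * Independent sets and the annihilation number *)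

(** The sum counts the adjacent pairs with first entry in [S]. The second entry is then outside [S],
    so the unordered edge determines the pair. *)
Lemma independent_sum_deg (G : sgraph) (S : {set G}) :
  independent S -> (\sum_(x in S) deg x <= #|edge_set G|)%N.
Proof.
move=> indS; rewrite /deg.
pose P := [set p : G * G | (p.1 \in S) && adj p.1 p.2].
have -> : (\sum_(x in S) #|[set y | adj x y]| = #|P|)%N.
  rewrite -sum1_card (eq_bigl (fun p => (p.1 \in S) && adj p.1 p.2)); last first.
    by move=> p; rewrite inE.
  rewrite -(pair_big_dep (mem S) (fun x y => adj x y) (fun _ _ => 1%N)) /=.
  by apply: eq_bigr => x _; rewrite sum1_card cardsE.
rewrite -(card_in_imset (f := fun p : G * G => [set p.1; p.2])).
  apply: subset_leq_card; apply/subsetP => _ /imsetP[p + ->].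
  by rewrite inE => /andP[_ pe]; apply: imset_f; rewrite inE.
move=> [a b] [c d]; rewrite !inE /= => /andP[aS ab] /andP[cS cd] /setP eqs.
have bNS : b \notin S by apply: contraTN ab => bS; apply: indS.
have dNS : d \notin S by apply: contraTN cd => dS; apply: indS.
have := eqs a; rewrite !inE eqxx /= => /esym/orP[/eqP ac|/eqP ad]; last first.
  by rewrite -ad aS in dNS.
have := eqs b; rewrite !inE eqxx orbT /= => /esym/orP[/eqP bc|/eqP bd].
  by rewrite bc cS in bNS.
by rewrite ac bd.
Qed.

(** If the heads [x] of [s] and [y] of [t] differ, then [y] occurs later in [s], so x <= y by
    sortedness, and the tails compare by induction. *)
Lemma sumn_take_subseq (s t : seq nat) :
  sorted leq s -> subseq t s -> (sumn (take (size t) s) <= sumn t)%N.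
Proof.
elim: s t => [|x s IH] [|y t] //= ps.
have ss := path_sorted ps.
case: eqP => [->|_] sub; first by rewrite leq_add2l IH.
have yx : (x <= y)%N.
  by apply: (allP (order_path_min leq_trans ps)); apply: mem_subseq sub _ (mem_head _ _).
apply: leq_add => //; apply: IH => //.
exact: subseq_trans (subseq_cons _ _) sub.
Qed.

Lemma independent_leq_annihilation (G : sgraph) (S : {set G}) :
  independent S -> (#|S| <= annihilation G)%N.
Proof.
move=> indS; have ltS : (#|S| < #|G|.+1)%N by rewrite ltnS max_card.
rewrite /annihilation.
apply: (@leq_bigmax_cond _ _ (fun a : 'I_#|G|.+1 => a : nat) (Ordinal ltS)) => /=.
apply: leq_trans (independent_sum_deg indS).
(* Sorting preserves subsequences, so [t] is a subsequence of [degree_seq G] and its sum bounds that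
   of the [#|S|] smallest degrees. *)
pose t := sort leq [seq deg x | x <- enum S].
have sub : subseq t (degree_seq G).
  apply: (subseq_sort leq_total leq_trans); apply: map_subseq.
  by rewrite (enumT G); apply: filter_subseq.
have sz : size t = #|S| by rewrite size_sort size_map -cardE.
rewrite -sz; apply: leq_trans (sumn_take_subseq _ sub) _.
  exact: sort_sorted leq_total _.
rewrite (perm_sumn (_ : perm_eq t [seq deg x | x <- enum S])) ?perm_sort //.
by rewrite sumnE big_map big_enum.
Qed.

Theorem theorem5 (R : realFieldType) (n : nat) (T : sgraph)
  (hT : is_tree T) (hn : #|T| = n) :
  ((nullity R T)%:Z <= 2 * (annihilation T)%:Z - n%:Z)%R.
Proof.
have [_ acT] := hT.
have [S [_ indS]] := forest_independent_rank R setT acT.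
have -> : induced_mx R setT = adjacency_mx R T.
  by apply/matrixP => i j; rewrite !mxE !inE !andbT.
rewrite cardsT => leS.
have symA : (adjacency_mx R T)^T = adjacency_mx R T.
  by apply/matrixP => i j; rewrite !mxE adj_sym.
(* With r the rank and s the size of [S], the nullity is at most n - r <= 2s - n <= 2a - n; the
   bound r <= n makes the truncated n - r exact. *)
have := mup_char_poly_sym symA; have := independent_leq_annihilation indS.
have := rank_leq_row (adjacency_mx R T); move: leS; rewrite -/(nullity R T) -hn.
by move: (\rank _) (nullity R T) #|S| => r k s; lia.
Qed.
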